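(* Let $c\in\mathbb{C}$, $V=V_{Vir}(c,0)$, and $n\in\mathbb{Z}_+$. Then $A_n(V)$ is generated by the elements \[ L(-2n-1)^{i_{2n+1}}L(-2n)^{i_{2n}}\cdots L(-2)^{i_2}\mathbf{1}+O_n(V)\quad\text{and}\quad L(-2)^j\mathbf{1}+O_n(V), \] where $i_2,\dots,i_{2n+1}\in\mathbb{N}$ with $0\le 2i_2\le n$, and $j\in\mathbb{Z}_+$.
   Context: The Virasoro algebra has basis $\bar L_m$ ($m\in\mathbb{Z}$) and central $\mathbf{c}$, with $[\bar L_m,\bar L_p]=(m-p)\bar L_{m+p}+\frac{m^3-m}{12}\delta_{m+p,0}\mathbf{c}$. $M(c,0)$ is the module induced from the one-dimensional module of the span of $\bar L_m$ ($m\ge0$) and $\mathbf{c}$ on which $\mathbf{c}$ acts by $c$ and all $\bar L_m$, $m\ge0$, act by $0$; write $L(m)$ for the action of $\bar L_m$. $V_{Vir}(c,0)=M(c,0)/\langle L(-1)\mathbf{1}\rangle$ is a vertex operator algebra with vacuum $\mathbf{1}$ and conformal vector $\omega=L(-2)\mathbf{1}$, $Y(\omega,x)=\sum_mL(m)x^{-m-2}$. For a vertex operator algebra $V$, $n\in\mathbb{N}$, homogeneous $u$: $u\circ_nv=\mathrm{Res}_x(1+x)^{\mathrm{wt}\,u+n}Y(u,x)v\,x^{-2n-2}$, $O_n(V)=\{(L(-1)+L(0))v\}+\mathrm{span}\{u\circ_nv\}$, $A_n(V)=V/O_n(V)$ with product $u*_nv=\sum_{m=0}^n(-1)^m\binom{m+n}{n}\mathrm{Res}_x(1+x)^{\mathrm{wt}\,u+n}Y(u,x)v\,x^{-n-m-1}$.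 *)

(* Defs.v *)
From mathcomp Require Import all_boot all_algebra complex.
From mathcomp Require Import Rstruct.
Set Implicit Arguments. Unset Strict Implicit. Unset Printing Implicit Defensive.
Import GRing.Theory.
Local Open Scope ring_scope.

Definition Cplx : fieldType := complex Rdefinitions.R.

Section Virasoro.
Variable F : fieldType.

(* A word [:: m1; ...; mk] stands for L(m1) L(m2) ... L(mk) 1 in M(c,0)
   (arbitrary integer modes allowed). *)
Definition word := seq int.
Definition fvec := seq (F * word).

Definition fcoef (v : fvec) (w : word) : F :=
  \sum_(p <- v) (if p.2 == w then p.1 else 0).
Definition fveq (v1 v2 : fvec) : Prop := forall w, fcoef v1 w = fcoef v2 w.

Definition fscale (k : F) (v : fvec) : fvec := [seq (k * p.1, p.2) | p <- v].
Definition fsub (v1 v2 : fvec) : fvec := v1 ++ fscale (-1) v2.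
Definition fsum (l : seq fvec) : fvec := flatten l.
Definition flincomb (l : seq (F * fvec)) : fvec :=
  flatten [seq fscale p.1 p.2 | p <- l].

Definition InSpan (S : fvec -> Prop) (v : fvec) : Prop :=
  exists l : seq (F * fvec), (forall p, List.In p l -> S p.2) /\ fveq v (flincomb l).

Definition Lact (m : int) (v : fvec) : fvec := [seq (p.1, m :: p.2) | p <- v].

Definition wt (w : word) : int := - \sum_(x <- w) x.

Definition gbinom (r : int) (i : nat) : F :=
  (\prod_(k < i) (r - k%:Z)%:~R) / (i`!)%:R.

Definition absn (z : int) : nat := `|z|%N.

(* Modes u_q v of the vertex operator Y(u,x) = sum_q u_q x^{-q-1},
   for words u, v.  Y(1,x) = id; for u = L(p) u' = omega_{p+1} u' we use
   the iterate (Borcherds) formula, with a = omega (a_j = L(j-1)), r = p+1: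
   (a_r b)_q v = sum_{i>=0} (-1)^i binom(r,i)
                   (a_{r-i} b_{q+i} v - (-1)^r b_{r+q-i} a_i v).
   Terms with i > |wt u'| + |wt v| + |q| + 2 vanish in V (they have negative
   weight), so the sum is truncated there. *)
Fixpoint fmode (u : word) (q : int) (v : word) {struct u} : fvec :=
  match u with
  | [::] => if q == -1 then [:: (1, v)] else [::]
  | p :: u' =>
      let r := p + 1 in
      let B := (absn (wt u') + absn (wt v) + absn q + 2)%N in
      flatten [seq
        fscale ((-1) ^+ i * gbinom r i)
          (fsub (Lact (r - i%:Z - 1) (fmode u' (q + i%:Z) v))
                (fscale ((-1) ^+ absn r)
                        (fmode u' (r + q - i%:Z) ((i%:Z - 1) :: v))))
        | i <- iota 0 B.+1]
  end.

Definition fmodeV (u : word) (q : int) (v : fvec) : fvec :=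
  flatten [seq fscale x.1 (fmode u q x.2) | x <- v].

Variable n : nat.

(* u o_n v = Res_x (1+x)^{wt u + n} Y(u,x) v x^{-2n-2}
           = sum_{i>=0} binom(wt u + n, i) u_{i-2n-2} v  (u a word, hence
   homogeneous of weight wt u); terms with larger i vanish in V. *)
Definition fcirc (u v : word) : fvec :=
  flatten [seq fscale (gbinom (wt u + n%:Z) i) (fmode u (i%:Z - (2 * n)%:Z - 2) v)
          | i <- iota 0 (absn (wt u) + absn (wt v) + 2 * n + 3)].

(* u *_n v = sum_{m=0}^n (-1)^m binom(m+n,n)
               Res_x (1+x)^{wt u+n} Y(u,x) v x^{-n-m-1}
           = sum_m (-1)^m binom(m+n,n) sum_i binom(wt u+n,i) u_{i-n-m-1} v. *)
Definition fstarW (u v : word) : fvec :=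
  flatten [seq fscale ((-1) ^+ m * ('C(m + n, n))%:R)
             (flatten [seq fscale (gbinom (wt u + n%:Z) i)
                             (fmode u (i%:Z - n%:Z - m%:Z - 1) v)
                      | i <- iota 0 (absn (wt u) + absn (wt v) + 2 * n + 3)])
          | m <- iota 0 n.+1].

Definition fstar (a b : fvec) : fvec :=
  flatten [seq fscale (x.1 * y.1) (fstarW x.2 y.2) | x <- a, y <- b].

Variable c : F.

(* Kernel of the map (formal combinations of words) -> A_n(V):
   - relations defining V_Vir(c,0) = M(c,0)/<L(-1)1> as a quotient of the
     free vector space on words: the Virasoro commutation relations
     (c acting by the scalar c) inserted anywhere, and L(m)1 = 0 for m >= -1;
   - the generators of O_n(V): (L(-1)+L(0)) v and u o_n v (u, v words). *)
Inductive NRel : fvec -> Prop :=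
  | NR_comm (w1 w2 : word) (a b : int) :
      NRel [:: (1, w1 ++ a :: b :: w2); (-1, w1 ++ b :: a :: w2);
               (- (a - b)%:~R, w1 ++ (a + b) :: w2);
               (- (if a + b == 0 then ((a ^+ 3 - a)%:~R / 12%:R) * c else 0),
                  w1 ++ w2)]
  | NR_ann (w : word) (m : int) : -1 <= m -> NRel [:: (1, rcons w m)]
  | NR_L (w : word) : NRel [:: (1, (-1) :: w); (1, 0 :: w)]
  | NR_circ (u v : word) : NRel (fcirc u v).

Definition AnEq (a b : fvec) : Prop := InSpan NRel (fsub a b).

(* the word L(-2n-1)^{i_{2n+1}} ... L(-2)^{i_2} 1, with ii k = i_{k+2} *)
Definition Lmono (ii : nat -> nat) : word :=
  flatten [seq nseq (ii k) (- (k + 2)%:Z) | k <- rev (iota 0 (2 * n))].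

Definition GenWord (w : word) : Prop :=
  (exists ii : nat -> nat, (2 * ii 0%N <= n)%N /\ w = Lmono ii)
  \/ (exists j : nat, (0 < j)%N /\ w = nseq j (-2)).

(* preimage of the subalgebra of (A_n(V), *_n) generated by the classes of
   the GenWord's (smallest subspace containing them and closed under *_n) *)
Inductive InGenAlg : fvec -> Prop :=
  | IG_gen (w : word) : GenWord w -> InGenAlg [:: (1, w)]
  | IG_add (a b : fvec) : InGenAlg a -> InGenAlg b -> InGenAlg (a ++ b)
  | IG_scale (k : F) (a : fvec) : InGenAlg a -> InGenAlg (fscale k a)
  | IG_mul (a b : fvec) : InGenAlg a -> InGenAlg b -> InGenAlg (fstar a b)
  | IG_eq (a b : fvec) : InGenAlg a -> AnEq a b -> InGenAlg b.

End Virasoro.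

(* Main.v *)
(* Filter V by the length of words. Modulo shorter words the modes L(m) commute
   and those with m >= -1 vanish; with D = L(-1) + L(0), the letter L(-j-2) is
   binom(D-2,j) applied to L(-2), and Y(u,x)v is (e^{xL(-1)} u) v. Since
   e^{xL(-1)} (1+x)^{L(0)} = (1+x)^D, the element u o_n v is
   binom(D_u+n,2n+1) u v, where D_u acts on the factor u only, so every block of
   letters has its D-eigenvalue in [-n,n], while u *_n v projects u to the
   eigenvalue 0.
   Let M be V modulo the generated subalgebra, and suppose that the words shorter
   than s vanish in M. A word of length s is then, in M, a combination of its
   values at tuples (d_1,...,d_s) of eigenvalues; no d_i is 0, because words that
   are *_n-products of shorter ones vanish, and if a of the d_i equal 2 then
   2a <= n, by the block condition. For j >= 1 the polynomial binom(D-2,j)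
   vanishes at 2, so for n >= 2 the generators with exactly a letters L(-2) kill
   the coefficients of the tuples with a entries 2, by induction on a. For n = 1
   only s = 2 and the tuples (1,-1), (-1,1) survive, and L(-2)^2 1 kills them. *)
Require Import Defs.
From HB Require Import structures.
From mathcomp Require Import all_boot all_algebra complex.
From mathcomp Require Import Rstruct.
From mathcomp Require Import boolp functions ring zify.
Set Implicit Arguments. Unset Strict Implicit. Unset Printing Implicit Defensive.
Import GRing.Theory.
Local Open Scope ring_scope.

(** * Quotients of vector spaces *)

Section QuotientModule.
Local Open Scope quotient_scope.
Variables (F : fieldType) (V : lmodType F) (H : V -> Prop).
Hypotheses (H0 : H 0) (HD : forall u v, H u -> H v -> H (u + v))
  (HZ : forall a v, H v -> H (a *: v)).

Definition subspace_pred : {pred V} := fun v => `[< H v >].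

Lemma subspace_predP : zmod_closed subspace_pred.
Proof.
split; first exact/asboolP.
move=> u v /asboolP Hu /asboolP Hv; apply/asboolP.
by rewrite -[- v]scaleN1r; apply: HD => //; apply: HZ.
Qed.

Definition subspace_closed : zmodClosed V :=
  HB.pack subspace_pred (GRing.isZmodClosed.Build V subspace_pred subspace_predP).

Local Notation Q := (Quotient.quot subspace_closed).

Definition quotmod := Q.
HB.instance Definition _ := GRing.Zmodule.on quotmod.

Lemma quotmod_piE (u v : V) :
  (\pi_(Q) u == \pi_(Q) v) = `[< H (u - v) >].
Proof. exact: (esym (Quotient.idealrBE subspace_closed u v)). Qed.

Definition quot_scale (a : F) (x : quotmod) : quotmod :=
  \pi_(Q) (a *: repr (x : Q)).

Lemma quot_scaleE a v :
  quot_scale a (\pi_(Q) v) = \pi_(Q) (a *: v).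
Proof.
apply/eqP; rewrite quotmod_piE -scalerBr; apply/asboolP; apply: HZ.
by apply/asboolP; rewrite -quotmod_piE reprK.
Qed.

Lemma quot_piD u v : \pi_(Q) (u + v) =
   \pi_(Q) u + \pi_(Q) v.
Proof. by rewrite !piE. Qed.

Lemma quot_scaleA a b v : quot_scale a (quot_scale b v) = quot_scale (a * b) v.
Proof. by rewrite -[v](@reprK _ Q) !quot_scaleE scalerA. Qed.

Lemma quot_scale1 : left_id 1 quot_scale.
Proof. by move=> v; rewrite -[v](@reprK _ Q) quot_scaleE scale1r. Qed.

Lemma quot_scaleDr : right_distributive quot_scale +%R.
Proof.
move=> a u v; rewrite -[v](@reprK _ Q) -[u](@reprK _ Q).
by rewrite -quot_piD !quot_scaleE scalerDr quot_piD.
Qed.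

Lemma quot_scaleDl v : {morph quot_scale^~ v : a b / a + b}.
Proof.
by move=> a b; rewrite -[v](@reprK _ Q) !quot_scaleE scalerDl quot_piD.
Qed.

HB.instance Definition _ := GRing.Zmodule_isLmodule.Build F quotmod
  quot_scaleA quot_scale1 quot_scaleDr quot_scaleDl.

Lemma quotient_module : exists (M : lmodType F) (f : V -> M),
  [/\ forall u v, f (u + v) = f u + f v, forall a v, f (a *: v) = a *: f v &
      forall v, f v = 0 <-> H v].
Proof.
exists quotmod, (fun v => \pi_(Q) v); split.
- exact: quot_piD.
- by move=> a v; exact: (esym (quot_scaleE a v)).
- move=> v; have -> : (0 : quotmod) = \pi_(Q) 0 by rewrite piE.
  split=> [/eqP | Hv].
    by rewrite quotmod_piE subr0 => /asboolP.
  by apply/eqP; rewrite quotmod_piE subr0; apply/asboolP.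
Qed.
End QuotientModule.

(** * Formal vectors *)

Section LinearExtension.
Variables (F : fieldType) (M : lmodType F).

Definition ev (th : word -> M) (v : fvec F) : M := \sum_(p <- v) p.1 *: th p.2.

Variable th : word -> M.

Lemma ev_nil : ev th [::] = 0. Proof. by rewrite /ev big_nil. Qed.

Lemma ev_cons p v : ev th (p :: v) = p.1 *: th p.2 + ev th v.
Proof. by rewrite /ev big_cons. Qed.

Lemma ev_cat u v : ev th (u ++ v) = ev th u + ev th v.
Proof. by rewrite /ev big_cat. Qed.

Lemma ev_scale k v : ev th (fscale k v) = k *: ev th v.
Proof.
by rewrite /ev big_map scaler_sumr; apply: eq_bigr => p _; rewrite scalerA.
Qed.

Lemma ev_sub u v : ev th (fsub u v) = ev th u - ev th v.
Proof. by rewrite ev_cat ev_scale scaleN1r. Qed.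

Lemma ev_flatten (I : Type) (s : seq I) (f : I -> fvec F) :
  ev th (flatten [seq f i | i <- s]) = \sum_(i <- s) ev th (f i).
Proof. by rewrite /ev big_flatten big_map. Qed.

Lemma ev_Lact m v : ev th (Lact m v) = ev (fun w => th (m :: w)) v.
Proof. by rewrite /ev big_map. Qed.
End LinearExtension.

Section FormalVectors.
Variable F : fieldType.

Lemma fcoefE (v : fvec F) w : fcoef v w = ev (fun w' => (w' == w)%:R : F^o) v.
Proof.
apply: eq_bigr => p _; case: eqP => _; first by rewrite [RHS]mulr1.
by rewrite scaler0.
Qed.

Lemma InGenAlg_fveq n (c : F) a b : InGenAlg n c a -> fveq a b -> InGenAlg n c b.
Proof.
move=> Ha ab; apply: (IG_eq Ha); exists [::]; split=> // w.
by move: (ab w); rewrite !fcoefE ev_sub => ->; rewrite subrr ev_nil.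
Qed.

Lemma AnEq0_NRel n (c : F) a : NRel n c a -> AnEq n c [::] a.
Proof.
move=> Ha; exists [:: (-1, a)]; split=> [p [<-|[]] // |w].
by rewrite !fcoefE ev_sub ev_flatten big_seq1 ev_scale ev_nil sub0r scaleN1r.
Qed.

Lemma GenWord_nil n : GenWord n [::].
Proof.
left; exists (fun=> 0%N); split=> //; rewrite /Lmono.
by elim: (rev _).
Qed.

Lemma InGenAlg_nil n (c : F) : InGenAlg n c [::].
Proof.
have /(IG_scale 0) := IG_gen c (GenWord_nil n).
by move/InGenAlg_fveq; apply=> w; rewrite !fcoefE ev_scale scale0r ev_nil.
Qed.

(* [M] is the quotient of the space of all formal vectors by the preimage of
   the generated subalgebra, so the theorem says that [M = 0]. *)
Lemma InGenAlg_quotient n (c : F) : exists (M : lmodType F) (th : word -> M),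
  forall v, ev th v = 0 <-> InGenAlg n c v.
Proof.
(* Formal vectors are lists, a vector space only up to [fveq]; the quotient is therefore taken in
   the space of functions on words. *)
pose H (f : word -> F^o) := exists2 v, InGenAlg n c v & f = fcoef v.
have H0 : H 0.
  exists [::]; first exact: InGenAlg_nil.
  by apply/funext => w; rewrite fcoefE ev_nil.
have HD u v : H u -> H v -> H (u + v).
  move=> [a Ha ->] [b Hb ->]; exists (a ++ b); first exact: IG_add.
  by apply/funext => w; rewrite fctE !fcoefE ev_cat.
have HZ k v : H v -> H (k *: v).
  move=> [a Ha ->]; exists (fscale k a); first exact: IG_scale.
  by apply/funext => w; rewrite fctE !fcoefE ev_scale.
have [M [f [fD fZ fP]]] := quotient_module H0 HD HZ.
exists M, (fun w => f (fcoef [:: (1, w)])) => v.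
have -> : ev (fun w => f (fcoef [:: (1, w)])) v = f (fcoef v).
  elim: v => [|[k w] v IH].
    rewrite ev_nil; apply/esym/fP; exists [::] => //; exact: InGenAlg_nil.
  rewrite ev_cons IH -fZ -fD; congr f; apply/funext => w'.
  rewrite -[LHS]/(k * fcoef [:: (1, w)] w' + fcoef v w') /fcoef !big_cons big_nil.
  by rewrite addr0 /=; case: eqP => _; rewrite ?mulr1 ?mulr0.
split=> [/fP[a Ha av] | Hv]; last by apply/fP; exists v.
by apply: (InGenAlg_fveq Ha) => w; rewrite -av.
Qed.
End FormalVectors.

(** * Generalized binomial coefficients and Newton interpolation *)

Section GeneralizedBinomials.
Variable F : fieldType.
Hypothesis F0 : [pchar F] =i pred0.

Lemma natr_eq0 k : (k%:R == 0 :> F) = (k == 0%N).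
Proof. by move/pcharf0P: F0. Qed.

Lemma intz_eq0 (k : int) : (k%:~R == 0 :> F) = (k == 0).
Proof. by case: k => k; rewrite ?NegzE ?rmorphN ?oppr_eq0 natr_eq0. Qed.

Lemma fact_neq0 i : (i`!)%:R != 0 :> F.
Proof. by rewrite natr_eq0 -lt0n fact_gt0. Qed.

Lemma gbinom0 r : gbinom F r 0 = 1.
Proof. by rewrite /gbinom big_ord0 mul1r invr1. Qed.

Lemma gbinomS r i : gbinom F r i.+1 * i.+1%:R = gbinom F r i * (r - i%:Z)%:~R.
Proof.
rewrite /gbinom big_ord_recr /= factS natrM.
by field; rewrite fact_neq0 addrC natr1 natr_eq0.
Qed.

Lemma gbinom_eq0 r i : (gbinom F r i == 0) = (0 <= r < i%:Z).
Proof.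
rewrite /gbinom mulf_eq0 invr_eq0 (negPf (fact_neq0 i)) orbF.
apply/prodf_eq0/idP => [[k _] | r_lt].
  by rewrite intz_eq0 subr_eq0 => /eqP->; rewrite /= ltz_nat ltn_ord.
case: r r_lt => // k; rewrite ltz_nat /= => k_lt.
by exists (Ordinal k_lt) => //; rewrite intz_eq0 subrr.
Qed.

Lemma gbinom_nn (k : nat) : gbinom F k k = 1.
Proof.
rewrite /gbinom -ffactnn ffact_prod natr_prod.
rewrite (_ : \prod_(i < k) _ = \prod_(i < k) (k - i)%:R) ?divff //.
  by apply/prodf_neq0 => i _; rewrite natr_eq0 subn_eq0 -ltnNge.
by apply: eq_bigr => i _; rewrite natrB ?(ltnW (ltn_ord i)) // rmorphB.
Qed.

Lemma gbinom_pascal r i : gbinom F (r + 1) i.+1 = gbinom F r i.+1 + gbinom F r i.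
Proof.
elim: i => [|i IH].
  have H1 := gbinomS (r + 1) 0; have H2 := gbinomS r 0.
  move: H1 H2; rewrite !mulr1 => -> ->; rewrite !gbinom0 !mul1r.
  by rewrite !subr0 rmorphD.
apply: (mulIf (_ : i.+2%:R != 0)); first by rewrite natr_eq0.
rewrite mulrDl !gbinomS IH; have := gbinomS r i.
rewrite !rmorphB rmorphD /= -!natr1 => E.
transitivity (gbinom F r i.+1 * (r%:~R + 1 - (i%:R + 1)) +
  (gbinom F r i * (r%:~R - i%:R))); first by ring.
by rewrite -E; ring.
Qed.

(** Both sides obey Pascal's rule in [a] and agree at [a = 0]. The rule is run upwards for positive
    [a] and downwards for negative [a], where it needs an inner induction on [k]. *)
Lemma Vandermonde_gbinom a b k :
  \sum_(i < k.+1) gbinom F a i * gbinom F b (k - i) = gbinom F (a + b) k.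
Proof.
pose S x m := \sum_(i < m.+1) gbinom F x i * gbinom F b (m - i).
rewrite -/(S a k).
have S0 x : S x 0%N = 1 by rewrite /S big_ord1 !gbinom0 mulr1.
have SS x m : S (x + 1) m.+1 = S x m.+1 + S x m.
  rewrite /S big_ord_recl [X in _ = X + _]big_ord_recl -addrA !gbinom0.
  congr (_ + _); rewrite -big_split /=; apply: eq_bigr => i _.
  by rewrite gbinom_pascal mulrDl subSS.
elim/int_rect: a k => [k|m IH k|m IH k].
- rewrite /S add0r big_ord_recl gbinom0 mul1r subn0 big1 ?addr0 // => i _.
  by rewrite (_ : gbinom _ _ _ = 0) ?mul0r //; apply/eqP; rewrite gbinom_eq0.
- case: k => [|k]; first by rewrite S0 gbinom0.
  by rewrite -addn1 PoszD SS !IH addrAC gbinom_pascal.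
- have E : - m%:Z = - m.+1%:Z + 1 by lia.
  elim: k => [|k IHk]; first by rewrite S0 gbinom0.
  have := IH k.+1; rewrite E SS addrAC gbinom_pascal IHk.
  exact: addIr.
Qed.

(** As [(-1)^i binom(-j-1, i) = binom(j+i, i)], this is trinomial revision [binom(j+i, i) binom(x,
    j+i) = binom(x, j) binom(x-j, i)]. *)
Lemma gbinom_trinomial x j i :
  (-1) ^+ i * gbinom F (- j.+1%:Z) i * gbinom F x (j + i) =
    gbinom F x j * gbinom F (x - j%:Z) i.
Proof.
elim: i => [|i IH]; first by rewrite addn0 !gbinom0 !mulr1 mul1r.
apply: (mulIf (_ : i.+1%:R != 0)); first by rewrite natr_eq0.
apply: (mulIf (_ : (j + i).+1%:R != 0)); first by rewrite natr_eq0.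
rewrite addnS.
transitivity (- ((-1) ^+ i * (gbinom F (- j.+1%:Z) i.+1 * i.+1%:R) *
  (gbinom F x (j + i).+1 * (j + i).+1%:R))); first by rewrite exprS; ring.
rewrite -[in RHS](mulrA (gbinom F x j)) !gbinomS.
transitivity ((-1) ^+ i * gbinom F (- j.+1%:Z) i * gbinom F x (j + i) *
  ((x - j%:Z - i%:Z)%:~R * (j + i).+1%:R)); last by rewrite IH; ring.
rewrite !rmorphB rmorphN /= -!natr1 natrD; ring.
Qed.

(* Newton interpolation at the points 2, 3, ...; in particular [e 0 = g.[2]]. *)
Lemma newton_expansion N (g : {poly F}) : (size g <= N)%N ->
  exists e : nat -> F, forall k : int,
    g.[k%:~R] = \sum_(j < N) e j * gbinom F (k - 2) j.
Proof.
elim: N g => [|N IH] g szg.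
  exists (fun=> 0) => k; move: szg; rewrite leqn0 size_poly_eq0 => /eqP->.
  by rewrite horner0 big_ord0.
(* [eN] is [N!] times the Newton polynomial of degree [N]; being monic, it removes the coefficient
   of degree [N] from [g]. *)
pose eN : {poly F} := \prod_(i < N) ('X - ((i + 2)%:R)%:P).
have eNE (k : int) : eN.[k%:~R] = (N`!)%:R * gbinom F (k - 2) N.
  rewrite /gbinom mulrC divfK ?fact_neq0 // horner_prod; apply: eq_bigr => i _.
  by rewrite !hornerE !rmorphB /= natrD; ring.
have szeN : size eN = N.+1.
  by rewrite /eN size_prod_XsubC /index_enum -enumT size_enum_ord.
have lcN : eN`_N = 1.
  have := monic_prod_XsubC (index_enum 'I_N) xpredT (fun i => (i + 2)%:R : F).
  by rewrite monicE lead_coefE -/eN szeN => /eqP.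
have [|e eE] := IH (g - g`_N *: eN).
  apply/leq_sizeP => j; rewrite leq_eqVlt => /orP[/eqP<-|Nj].
    by rewrite coefB coefZ lcN mulr1 subrr.
  rewrite coefB coefZ (nth_default _ (leq_trans szg Nj)).
  by rewrite [eN`_j]nth_default ?szeN // mulr0 subr0.
exists (fun j => if (j < N)%N then e j else g`_N * (N`!)%:R) => k.
rewrite big_ord_recr /= ltnn -mulrA -eNE.
under eq_bigr => i _ do rewrite ltn_ord.
by rewrite -eE hornerD hornerN hornerZ subrK.
Qed.

(* [e] lists the coefficients, in Newton's basis, of the Lagrange polynomial of
   the node [k0]. *)
Lemma lagrange_newton (nodes : seq int) k0 N : uniq nodes -> k0 \in nodes ->
  (size nodes <= N)%N -> exists e : nat -> F, forall k, k \in nodes ->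
    \sum_(j < N) e j * gbinom F (k - 2) j = (k == k0)%:R.
Proof.
move=> un k0n szN.
pose r := [seq k <- nodes | k != k0].
pose g : {poly F} := (\prod_(k <- r) (k0 - k)%:~R)^-1 *:
  \prod_(k <- r) ('X - (k%:~R)%:P).
have szg : (size g <= N)%N.
  apply: leq_trans (size_scale_leq _ _) _; rewrite size_prod_XsubC.
  apply: leq_trans szN; rewrite size_filter -(count_predC (pred1 k0)) -addn1 addnC.
  by rewrite leq_add2r // -has_count has_pred1.
have [e eE] := newton_expansion szg; exists e => k kn.
rewrite -eE hornerZ horner_prod; have [->|kk0] := eqVneq k k0.
  under [in X in _^-1 * X]eq_bigr => i _ do rewrite !hornerE -rmorphB.
  rewrite mulVf //; rewrite prodf_seq_neq0; apply/allP => i.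
  rewrite mem_filter => /andP[ik _] /=.
  by rewrite intz_eq0 subr_eq0 eq_sym.
rewrite [X in _ * X](big_rem k) ?mem_filter ?kk0 //=.
by rewrite hornerXsubC subrr mul0r mulr0.
Qed.
End GeneralizedBinomials.

(** * Multilinear functions of words *)

Lemma perm_invariant (T : eqType) (X : Type) s (g : seq T -> X) :
  (forall w1 a b w2, size (w1 ++ a :: b :: w2) = s ->
     g (w1 ++ a :: b :: w2) = g (w1 ++ b :: a :: w2)) ->
  forall w w', size w = s -> perm_eq w w' -> g w = g w'.
Proof.
elim: s g => [|s IH] g swap w w' sw ww'.
  have := perm_size ww'; rewrite sw => /esym/size0nil->.
  by rewrite (size0nil sw).
have move_front d1 : forall pre x d2, size (pre ++ d1 ++ x :: d2) = s.+1 ->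
    g (pre ++ d1 ++ x :: d2) = g (pre ++ x :: d1 ++ d2).
  elim: d1 => [|a d1 IHd] // pre x d2 sz.
  rewrite -[pre ++ _]/(pre ++ (a :: d1 ++ x :: d2)) -cat_rcons IHd.
    by rewrite cat_rcons swap // -sz !size_cat /= !size_cat /=; lia.
  by rewrite -sz size_cat size_rcons !size_cat /= addSnnS.
case: w sw ww' => // x w [sw] ww'.
have xw' : x \in w' by rewrite -(perm_mem ww') mem_head.
move: (perm_size ww'); case/splitPr: xw' ww' => d1 d2 ww' sz.
rewrite (move_front d1 [::]) /=; last by rewrite -sz /= sw.
apply: (IH (fun w => g (x :: w))) => // [w1 a b w2 sz'|].
  by rewrite -!cat_cons swap //= sz'.
by rewrite -(perm_cons x) (perm_trans ww') // -(cat1s x d2) perm_catCA.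
Qed.

Section Letters.
Variable F : fieldType.

Definition letter (j : nat) : int := Negz j.+1.

(* Modulo shorter words, [L(p)] with [p <= -2] stands for the polynomial
   [binom(D - 2, -p - 2)] in the derivation [D = L(-1) + L(0)], applied to
   [L(-2)]; [letter_at k p] is its value at [D = k]. *)
Definition letter_at (k p : int) : F :=
  if p is Negz j.+1 then gbinom F (k - 2) j else 0.

(** Each letter acts in its own slot with its own copy of [D], so the values at a tuple multiply; a
    tuple of the wrong length gives 0. *)
Fixpoint word_at (d w : seq int) : F :=
  match d, w with
  | [::], [::] => 1
  | k :: d', p :: w' => letter_at k p * word_at d' w'
  | _, _ => 0
  end.

Lemma letter_at_ge k (p : int) : (-1 : int) <= p -> letter_at k p = 0.
Proof. by case: p => [|[]]. Qed.

Lemma letter_split (p : int) : (-1 : int) <= p \/ exists j, p = letter j.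
Proof. by case: p => [m|[|j]]; [left | left | right; exists j]. Qed.

Lemma word_at_cat d1 d2 u v : size d1 = size u ->
  word_at (d1 ++ d2) (u ++ v) = word_at d1 u * word_at d2 v.
Proof.
elim: d1 u => [|k d1 IH] [|p u] //= => [_|[sz]]; first by rewrite mul1r.
by rewrite IH // mulrA.
Qed.

Fixpoint points (nodes : seq int) (s : nat) : seq (seq int) :=
  if s is s'.+1 then [seq k :: d | k <- nodes, d <- points nodes s']
  else [:: [::]].

Lemma mem_points nodes s d :
  (d \in points nodes s) = (size d == s) && all (mem nodes) d.
Proof.
elim: s d => [|s IH] [|k d] //=.
  by apply/allpairsP => -[[x y] []].
rewrite eqSS; apply/allpairsP/idP => [[[x y] /= [xn yp [-> ->]]]|].
  by move: yp; rewrite IH => /andP[-> ->]; rewrite xn.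
by case/and3P=> sz kn dn; exists (k, d); rewrite /= IH sz.
Qed.

Lemma sum_points_cat (V : nmodType) nodes a b (G : seq int -> V) :
  \sum_(d <- points nodes (a + b)) G d =
  \sum_(d1 <- points nodes a) \sum_(d2 <- points nodes b) G (d1 ++ d2).
Proof.
elim: a G => [|a IH] G /=; first by rewrite big_seq1.
by rewrite !big_allpairs_dep; apply: eq_bigr => k _; rewrite IH.
Qed.

Section Expansion.
Variables (M : lmodType F) (nodes : seq int) (N : nat) (alpha : int -> nat -> F).

(* [phi th] is the coefficient function of [th] in the expansion of a
   multilinear function of the letters over tuples of eigenvalues of [D]. *)
Fixpoint phi (th : word -> M) (d : seq int) : M :=
  if d is k :: d' then
    \sum_(j < N) alpha k j *: phi (fun w => th (letter j :: w)) d'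
  else th [::].

Lemma phi_ext th th' d : (forall w, size w = size d -> th w = th' w) ->
  phi th d = phi th' d.
Proof.
elim: d th th' => [|k d IH] th th' E /=; first exact: E.
by apply: eq_bigr => j _; congr (_ *: _); apply: IH => w sw; apply: E; rewrite /= sw.
Qed.

Lemma phi_perm th d d' :
  (forall w w', size w = size d -> perm_eq w w' -> th w = th w') ->
  perm_eq d d' -> phi th d = phi th d'.
Proof.
move=> Hth; apply: (@perm_invariant _ _ (size d)) => // w1 a b w2.
elim: w1 th (size d) Hth => [|k w1 IH] th s Hth sz /=; last first.
  apply: eq_bigr => j _; congr (_ *: _).
  apply: (IH _ (size (w1 ++ a :: b :: w2))) => // w w' sw ww'.
  by apply: Hth; rewrite /= ?perm_cons // sw -sz.
under eq_bigr => j _ do rewrite scaler_sumr.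
under [in RHS]eq_bigr => j _ do rewrite scaler_sumr.
rewrite exchange_big; apply: eq_bigr => i _; apply: eq_bigr => j _ /=.
rewrite !scalerA mulrC; congr (_ *: _); apply: phi_ext => w sw.
apply: Hth; first by rewrite -sz /= sw.
by rewrite -[_ :: _ :: w]/([:: letter j; letter i] ++ w) perm_catC
  -[_ :: _ :: w in X in perm_eq _ X]/([:: letter i; letter j] ++ w) perm_sym
  perm_catC perm_cat2l -[[:: letter i; _]]/([:: letter i] ++ [:: letter j]) perm_catC.
Qed.

(** The hypothesis expands one slot. It is applied to the first letter, and the induction treats the
    other slots with that letter replaced by each [letter j]. *)
Lemma phi_expansion s th :
  (forall w1 p w2, (size w1 + size w2).+1 = s ->
    th (w1 ++ p :: w2) = \sum_(k <- nodes) letter_at k p *: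
      \sum_(j < N) alpha k j *: th (w1 ++ letter j :: w2)) ->
  forall w, size w = s -> th w = \sum_(d <- points nodes s) word_at d w *: phi th d.
Proof.
elim: s th => [|s IH] th slot [|p w] //= => [_|[sw]].
  by rewrite big_seq1 scale1r.
rewrite (slot [::] p w) /= ?sw // big_allpairs_dep; apply: eq_bigr => k _.
under [RHS]eq_bigr => d _ do rewrite -scalerA.
rewrite -scaler_sumr; congr (_ *: _).
under [RHS]eq_bigr => d _ do rewrite scaler_sumr.
rewrite exchange_big; apply: eq_bigr => j _ /=.
rewrite (IH (fun w => th (letter j :: w))) // => [|w1 q w2 sz]; last first.
  by rewrite -!cat_cons (slot (letter j :: w1)) //= addSn sz.
rewrite scaler_sumr; apply: eq_bigr => d _.
by rewrite !scalerA mulrC.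
Qed.

(** Slots are stripped off one at a time: the combination [e] of the relations over the first letter
    isolates [k0]. Bad eigenvalues need no separation because [psi] vanishes there; those neither
    good nor bad are killed by [e] but never isolated themselves. *)
Lemma points_extraction (J : seq nat) (good bad : pred int) :
  uniq nodes ->
  (forall k0, k0 \in nodes -> good k0 -> exists e : nat -> F,
    forall k, k \in nodes -> ~~ bad k ->
      \sum_(j <- J) e j * letter_at k (letter j) = (k == k0)%:R) ->
  forall s (psi : seq int -> M),
  (forall d, d \in points nodes s -> has bad d -> psi d = 0) ->
  (forall js, size js = s -> all (mem J) js ->
    \sum_(d <- points nodes s) word_at d (map letter js) *: psi d = 0) ->
  forall d, d \in points nodes s -> all good d -> psi d = 0.
Proof.
move=> un sep; elim=> [|s IH] psi bad0 sum0 d.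
  rewrite inE => /eqP-> _.
  by have := sum0 [::] erefl isT; rewrite big_seq1 scale1r.
rewrite mem_points; case: d => [|k0 d] //=; rewrite eqSS.
case/and3P=> sd k0n dn /andP[gk0 gd].
have [e eE] := sep k0 k0n gk0.
apply: (IH (fun d => psi (k0 :: d))) => // [d' d'p bd'|js sjs jsJ|].
- apply: bad0; last by rewrite /= bd' orbT.
  by move: d'p; rewrite !mem_points /= k0n eqSS.
- pose G k := \sum_(d <- points nodes s) word_at d (map letter js) *: psi (k :: d).
  rewrite -/(G k0).
  have E (j : nat) : j \in J -> \sum_(k <- nodes) letter_at k (letter j) *: G k = 0.
    move=> jJ; have /= := sum0 (j :: js); rewrite sjs jJ jsJ => /(_ erefl isT) E.
    rewrite -[RHS]E big_allpairs_dep; apply: eq_bigr => k _; rewrite scaler_sumr.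
    by apply: eq_bigr => d' _; rewrite scalerA.
  have: \sum_(j <- J) e j *: \sum_(k <- nodes) letter_at k (letter j) *: G k = 0.
    by rewrite big_seq big1 // => j jJ; rewrite E // scaler0.
  under eq_bigr => j _ do rewrite scaler_sumr.
  rewrite exchange_big /= (bigD1_seq k0) //= [X in _ + X]big1_seq ?addr0.
    under eq_bigr => j _ do rewrite scalerA.
    rewrite -scaler_suml; have [bk0|nbk0] := boolP (bad k0); last first.
      by rewrite eE // eqxx scale1r.
    move=> _; rewrite /G big_seq big1 // => d' d'p; rewrite bad0 ?scaler0 //.
      by move: d'p; rewrite !mem_points /= k0n eqSS.
    by rewrite /= bk0.
  move=> k /andP[kk0 kn].
  under eq_bigr => j _ do rewrite scalerA.
  rewrite -scaler_suml; have [bk|nbk] := boolP (bad k); last first.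
    by rewrite eE // (negPf kk0) scale0r.
  rewrite (_ : G k = 0) ?scaler0 // /G big_seq big1 // => d' d'p; rewrite bad0 ?scaler0 //.
    by move: d'p; rewrite !mem_points /= kn eqSS.
  by rewrite /= bk.
- by rewrite mem_points sd.
Qed.
End Expansion.
End Letters.

(** * Modes modulo shorter words *)

Section Modes.
Variable F : fieldType.
Hypothesis F0 : [pchar F] =i pred0.

Definition homog (s : nat) (x : fvec F) := all (fun p => size p.2 == s) x.

Lemma homog_flatten s (I : Type) (r : seq I) (f : I -> fvec F) :
  (forall i, homog s (f i)) -> homog s (flatten [seq f i | i <- r]).
Proof. by move=> Hf; elim: r => //= i r IH; rewrite /homog all_cat -!/(homog _ _) Hf. Qed.

Lemma homog_scale s k x : homog s (fscale k x) = homog s x.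
Proof. by rewrite /homog all_map. Qed.

Lemma fmode_cons p u q v : fmode F (p :: u) q v =
  flatten [seq fscale ((-1) ^+ i * gbinom F (p + 1) i)
    (fsub (Lact (p + 1 - i%:Z - 1) (fmode F u (q + i%:Z) v))
      (fscale ((-1) ^+ absn (p + 1))
        (fmode F u (p + 1 + q - i%:Z) (i%:Z - 1 :: v))))
    | i <- iota 0 (absn (wt u) + absn (wt v) + absn q + 3)].
Proof. by rewrite addn3 /= addn2. Qed.

Lemma homog_fmode u q v : homog (size u + size v) (fmode F u q v).
Proof.
elim: u q v => [|p u IH] q v.
  by rewrite /=; case: eqP => //= _; rewrite /homog /= eqxx.
rewrite fmode_cons; apply: homog_flatten => i; rewrite homog_scale /homog all_cat.
rewrite -!/(homog _ _) !homog_scale /homog /Lact all_map; apply/andP; split.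
  by apply: sub_all (IH (q + i%:Z) v) => x /= /eqP ->.
by have := IH (p + 1 + q - i%:Z) ((i%:Z - 1) :: v); rewrite /= addnS.
Qed.

Lemma homog_fcirc n u v : homog (size u + size v) (fcirc F n u v).
Proof. by apply: homog_flatten => i; rewrite homog_scale homog_fmode. Qed.

Lemma homog_fstarW n u v : homog (size u + size v) (fstarW F n u v).
Proof.
apply: homog_flatten => m; rewrite homog_scale.
by apply: homog_flatten => i; rewrite homog_scale homog_fmode.
Qed.

Lemma ev_expansion (M : lmodType F) (th : word -> M) (ds : seq (seq int))
    (ph : seq int -> M) s x :
  (forall w, size w = s -> th w = \sum_(d <- ds) word_at F d w *: ph d) ->
  homog s x -> ev th x =
    \sum_(d <- ds) (ev (fun w => word_at F d w : F^o) x : F) *: ph d.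
Proof.
move=> E; elim: x => [|[k w] x IH].
  by rewrite !ev_nil big1 // => d _; rewrite ev_nil scale0r.
case/andP=> /= /eqP sw Hx; rewrite ev_cons IH //= E // scaler_sumr -big_split.
by apply: eq_bigr => d _ /=; rewrite ev_cons scalerDl scalerA.
Qed.

Lemma word_at_eq0 d w1 (p : int) w2 : (-1 : int) <= p -> word_at F d (w1 ++ p :: w2) = 0.
Proof.
move=> p_ge; elim: w1 d => [|x w1 IH] [|k d] //=.
  by rewrite letter_at_ge // mul0r.
by rewrite IH mulr0.
Qed.

(** The coefficient of [t^(-q-1)] in [(1+t)^x]. *)
Definition mode_coef (x q : int) : F := if q is Negz m then gbinom F x m else 0.

(** This is the coefficient of [t^m] in [(1+t)^a (1+t)^x]; a truncation beyond [m] sees all its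
    terms. *)
Lemma sum_mode_coef a x m K : (m < K)%N ->
  \sum_(i <- iota 0 K) gbinom F a i * mode_coef x (Negz m + i%:Z) =
  gbinom F (a + x) m.
Proof.
move=> mK; rewrite -[K]subn0 -/(index_iota 0 _) (big_cat_nat (leq0n m.+1) mK) /=.
rewrite [X in _ + X]big_nat [X in _ + X]big1 ?addr0 => [|i /andP[mi _]]; last first.
  have -> : Negz m + i%:Z = Posz (i - m.+1) by lia.
  by rewrite mulr0.
rewrite big_mkord -Vandermonde_gbinom //; apply: eq_bigr => i _.
have -> : Negz m + i%:Z = Negz (m - i) by have := ltn_ord i; lia.
by [].
Qed.

(** [(-1)^i binom(p+1, i) L(p-i)] is the coefficient of [t^i] in [e^(t ad L(-1))] applied to [L(p)].
    On a letter of weight [j+2] it acts at [D = k] as the coefficient of [t^i] in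
    [(1+t)^(k-2-j)]. *)
Lemma letter_at_shift k j i :
  (-1) ^+ i * gbinom F (letter j + 1) i * letter_at F k (letter j - i%:Z) =
  letter_at F k (letter j) * gbinom F (k - 2 - j%:Z) i.
Proof.
have -> : letter j + 1 = - j.+1%:Z by rewrite /letter; lia.
have -> : letter j - i%:Z = letter (j + i) by rewrite /letter; lia.
exact: gbinom_trinomial.
Qed.

Lemma letter_at_shift_ge k (p : int) i : (-1 : int) <= p ->
  gbinom F (p + 1) i * letter_at F k (p - i%:Z) = 0.
Proof.
move=> p_ge; have [pi|pi] := boolP ((-1 : int) <= p - i%:Z).
  by rewrite letter_at_ge ?mulr0.
rewrite (_ : gbinom _ _ _ = 0) ?mul0r //; apply/eqP; rewrite gbinom_eq0 //; lia.
Qed.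

Lemma wt_cons p u : wt (p :: u) = wt u - p.
Proof. by rewrite /wt big_cons opprD addrC. Qed.

(* The top-length part of [Y(u,x)v] is [(e^{xT}u) v]; at a point [d1] it is
   [u v] times [(1+x)^(sum d1 - wt u)]. *)
Lemma ev_fmode u q v d1 d2 : size d1 = size u -> size d2 = size v ->
  ev (fun w => word_at F (d1 ++ d2) w : F^o) (fmode F u q v) =
  mode_coef (\sum_(k <- d1) k - wt u) q * word_at F (d1 ++ d2) (u ++ v).
Proof.
elim: u q v d1 d2 => [|p u IH] q v d1 d2 sd1 sd2.
  rewrite /= (size0nil sd1) /wt !big_nil subr0 /=.
  case: q => [q|[|m]] /=; rewrite ?ev_cons ?ev_nil ?mul0r //.
    by rewrite gbinom0 addr0.
  by rewrite (_ : gbinom _ _ _ = 0) ?mul0r //; apply/eqP; rewrite gbinom_eq0.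
case: d1 sd1 => // k d1 [sd1]; rewrite fmode_cons ev_flatten.
set B := (_ + 3)%N; set W := word_at F (d1 ++ d2) (u ++ v).
set x := \sum_(k <- d1) k - wt u.
have term i : ev (fun w => word_at F (k :: d1 ++ d2) w : F^o)
    (fscale ((-1) ^+ i * gbinom F (p + 1) i)
       (fsub (Lact (p + 1 - i%:Z - 1) (fmode F u (q + i%:Z) v))
          (fscale ((-1) ^+ absn (p + 1))
             (fmode F u (p + 1 + q - i%:Z) (i%:Z - 1 :: v))))) =
    (-1) ^+ i * gbinom F (p + 1) i * letter_at F k (p - i%:Z) *
      mode_coef x (q + i%:Z) * W.
  rewrite ev_scale ev_sub ev_Lact ev_scale.
  (* This half of the iterate formula inserts [L(i-1)] with [i - 1 >= -1], and words with such a
     letter have value 0. *)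
  have -> : ev (fun w => word_at F (k :: d1 ++ d2) w : F^o)
     (fmode F u (p + 1 + q - i%:Z) (i%:Z - 1 :: v)) = 0.
    rewrite -(cat_take_drop (size u) (k :: d1 ++ d2)) IH.
    - by rewrite word_at_eq0 ?mulr0 //; lia.
    - by rewrite size_takel //= size_cat sd1; lia.
    - by rewrite size_drop /= size_cat sd1 sd2; lia.
  rewrite scaler0 subr0 (_ : p + 1 - i%:Z - 1 = p - i%:Z); last by lia.
  transitivity ((-1) ^+ i * gbinom F (p + 1) i * (letter_at F k (p - i%:Z) *
    ev (fun w => word_at F (d1 ++ d2) w : F^o) (fmode F u (q + i%:Z) v))).
    congr (_ * _); rewrite /ev mulr_sumr; apply: eq_bigr => y _.
    by rewrite /GRing.scale /= mulrCA.
  by rewrite IH // -/x -/W !mulrA.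
under eq_bigr => i _ do rewrite term.
rewrite -[word_at F ((k :: d1) ++ d2) _]/(letter_at F k p * W) big_cons wt_cons.
have [p_ge|[j ->]] := letter_split p.
  rewrite letter_at_ge // mul0r mulr0 big1 // => i _.
  by rewrite -(mulrA _ (gbinom _ _ _)) letter_at_shift_ge // mulr0 !mul0r.
under eq_bigr => i _ do rewrite letter_at_shift.
under eq_bigr => i _ do
  rewrite -(mulrA (letter_at _ _ _)) -(mulrA (letter_at _ _ _)).
rewrite -mulr_sumr [RHS]mulrCA; congr (_ * _).
rewrite -mulr_suml; congr (_ * _).
case: q @B {term} => [q|m] B.
  by rewrite big1 // => i _; rewrite -PoszD mulr0.
rewrite sum_mode_coef; last by rewrite /B /absn; lia.
rewrite (_ : letter j = - j%:Z - 2); last by rewrite /letter; lia.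
by congr (gbinom _ _ _); rewrite /x; ring.
Qed.

(** The exponents [wt u + n] and [sum d1 - wt u] add up, so the weight cancels and the residue is a
    single binomial coefficient. *)
Lemma ev_fcirc n u v d1 d2 : size d1 = size u -> size d2 = size v ->
  ev (fun w => word_at F (d1 ++ d2) w : F^o) (fcirc F n u v) =
  gbinom F (\sum_(k <- d1) k + n%:Z) (2 * n + 1) * word_at F (d1 ++ d2) (u ++ v).
Proof.
move=> sd1 sd2; rewrite ev_flatten.
under eq_bigr => i _.
  rewrite ev_scale ev_fmode // /GRing.scale /= mulrA.
  rewrite (_ : i%:Z - (2 * n)%:Z - 2 = Negz (2 * n + 1) + i%:Z); last by lia.
over.
rewrite -mulr_suml sum_mode_coef; last by lia.
by congr (gbinom _ _ _ * _); ring.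
Qed.

Definition star_coef (n : nat) (x : int) : F :=
  \sum_(m <- iota 0 n.+1) (-1) ^+ m * ('C(m + n, n))%:R *
    gbinom F (x + n%:Z) (n + m).

Lemma star_coef0 n : star_coef n 0 = 1.
Proof.
rewrite /star_coef -[n.+1]subn0 -/(index_iota 0 _) big_nat_recl // add0n binn.
rewrite addn0 add0r gbinom_nn // !mul1r big1 ?addr0 // => m _.
by rewrite (_ : gbinom _ _ _ = 0) ?mulr0 //; apply/eqP; rewrite gbinom_eq0 //; lia.
Qed.

Lemma ev_fstarW n u v d1 d2 : size d1 = size u -> size d2 = size v ->
  ev (fun w => word_at F (d1 ++ d2) w : F^o) (fstarW F n u v) =
  star_coef n (\sum_(k <- d1) k) * word_at F (d1 ++ d2) (u ++ v).
Proof.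
move=> sd1 sd2; rewrite ev_flatten mulr_suml; apply: eq_big_seq => m.
rewrite mem_iota => m_lt; rewrite ev_scale ev_flatten.
under eq_bigr => i _.
  rewrite ev_scale ev_fmode // /GRing.scale /= mulrA.
  rewrite (_ : i%:Z - n%:Z - m%:Z - 1 = Negz (n + m) + i%:Z); last by lia.
over.
rewrite -mulr_suml sum_mode_coef; last by lia.
rewrite -[LHS]/(_ * _) mulrA.
by congr (_ * gbinom _ _ _ * _); ring.
Qed.
End Modes.

(** * Expansion over eigenvalues *)

Definition nodes (n : nat) : seq int := [seq i%:Z - n%:Z | i <- iota 0 (2 * n + 1)].

Lemma mem_nodes n (k : int) : (k \in nodes n) = (`|k|%N <= n)%N.
Proof.
apply/mapP/idP => [[i i_lt ->]|kn]; first by move: i_lt; rewrite mem_iota; lia.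
by exists (absz (k + n%:Z)); rewrite ?mem_iota; lia.
Qed.

Lemma uniq_nodes n : uniq (nodes n).
Proof. by rewrite map_inj_uniq ?iota_uniq // => i j; lia. Qed.

Lemma size_nodes n : size (nodes n) = (2 * n + 1)%N.
Proof. by rewrite size_map size_iota. Qed.

Lemma sum_iota0 (V : nmodType) N (f : nat -> V) :
  \sum_(j <- iota 0 N) f j = \sum_(j < N) f j.
Proof. by rewrite -(big_mkord xpredT f) /index_iota subn0. Qed.

Lemma sum_nodes (V : nmodType) n (f : int -> V) :
  \sum_(k <- nodes n) f k = \sum_(x < 2 * n + 1) f (x%:Z - n%:Z).
Proof. by rewrite big_map sum_iota0. Qed.

Section Slots.
Variable F : fieldType.
Hypothesis F0 : [pchar F] =i pred0.
Variable n : nat.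

(** The values of the first [2n+1] letters at the [2n+1] nodes form a square matrix. Lagrange
    interpolation provides a left inverse [alpha], which is then also a right inverse. *)
Lemma dual_basis_exists : exists alpha : int -> nat -> F,
  (forall k k', k \in nodes n -> k' \in nodes n ->
    \sum_(j < 2 * n + 1) alpha k j * letter_at F k' (letter j) = (k' == k)%:R) /\
  (forall i j : nat, (i < 2 * n + 1)%N -> (j < 2 * n + 1)%N ->
    \sum_(k <- nodes n) letter_at F k (letter i) * alpha k j = (i == j)%:R).
Proof.
have /choice[alpha alphaE] : forall k, exists e : nat -> F, k \in nodes n ->
    forall k', k' \in nodes n ->
    \sum_(j < 2 * n + 1) e j * letter_at F k' (letter j) = (k' == k)%:R.
  move=> k; have [kn|/negPf kn] := boolP (k \in nodes n); last by exists (fun=> 0).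
  have [e eE] := lagrange_newton F0 (uniq_nodes n) kn (eq_leq (size_nodes n)).
  by exists e.
exists alpha; split=> [k k' kn k'n|i j iN jN]; first exact: alphaE.
pose nd (i : 'I_(2 * n + 1)) : int := i%:Z - n%:Z.
have ndn x : nd x \in nodes n by rewrite mem_nodes /nd; have := ltn_ord x; lia.
pose A := \matrix_(x, y < 2 * n + 1) alpha (nd x) y.
pose B := \matrix_(x, y < 2 * n + 1) letter_at F (nd y) (letter x).
have AB : A *m B = 1%:M.
  apply/matrixP => x y; rewrite !mxE; under eq_bigr => z _ do rewrite !mxE.
  rewrite alphaE // (_ : (nd y == nd x) = (x == y)) //.
  by rewrite eq_sym /nd -val_eqE /=; lia.
have /matrixP/(_ (Ordinal iN) (Ordinal jN)) := mulmx1C AB.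
by rewrite !mxE sum_nodes => <-; apply: eq_bigr => x _; rewrite !mxE.
Qed.

(** * The recurrence satisfied by a single letter *)

Section Recurrence.
Variables (M : lmodType F) (alpha : int -> nat -> F).
Hypothesis alphaE : forall i j : nat, (i < 2 * n + 1)%N -> (j < 2 * n + 1)%N ->
  \sum_(k <- nodes n) letter_at F k (letter i) * alpha k j = (i == j)%:R.

(** The coefficient of [L(p - (2n+1-i)) v] in [u o_n v] for [u = L(p) 1], modulo vanishing words:
    the first factor comes from [(1+x)^(wt u + n)], the second from [e^(xL(-1))]. *)
Definition rec_coef (p : int) (i : nat) : F := gbinom F (n%:Z - p) i *
  ((-1) ^+ (2 * n + 1 - i) * gbinom F (p + 1) (2 * n + 1 - i)).

(** By trinomial revision and Vandermonde the sum is a multiple of [binom(k+n, 2n+1)], and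
    [0 <= k+n <= 2n]. *)
Lemma rec_letter_at k j : k \in nodes n ->
  \sum_(i < 2 * n + 2) rec_coef (letter j) i *
    letter_at F k (letter j - (2 * n + 1 - i)%N%:Z) = 0.
Proof.
rewrite mem_nodes => kn.
under eq_bigr => i _ do rewrite -mulrA letter_at_shift // mulrCA.
rewrite -mulr_sumr addnS Vandermonde_gbinom //.
rewrite (_ : gbinom _ _ _ = 0) ?mulr0 //; apply/eqP; rewrite gbinom_eq0 //.
by rewrite /letter; lia.
Qed.

(** For [i = 0] the coefficient is, up to sign, [binom(-j-1, 2n+1)], which is nonzero; hence the
    first [2n+1] values determine the others. *)
Lemma rec_unique (ka : int -> M) :
  (forall j, \sum_(i < 2 * n + 2) rec_coef (letter j) i *:
    ka (letter j - (2 * n + 1 - i)%N%:Z) = 0) ->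
  (forall j, (j < 2 * n + 1)%N -> ka (letter j) = 0) -> forall j, ka (letter j) = 0.
Proof.
move=> rec init; elim/ltn_ind => j IH.
have [/init //|jn] := ltnP j (2 * n + 1).
have := rec (j - (2 * n + 1))%N; rewrite addnS big_ord_recl subn0.
rewrite (_ : letter _ - _ = letter j); last by rewrite /letter; lia.
rewrite big1 ?addr0 => [/eqP|i _]; last first.
  rewrite (_ : letter _ - _ = letter (j - i.+1)).
    by rewrite IH ?scaler0 //; lia.
  by rewrite /letter /= /bump /=; have := ltn_ord i; lia.
rewrite scaler_eq0 /rec_coef gbinom0 mul1r subn0 mulf_eq0 signr_eq0 gbinom_eq0 //.
by case: (boolP (0 <= _)) => [|_ /eqP//]; rewrite /letter; lia.
Qed.

(** Both sides solve the recurrence of order [2n+1] and agree on the first [2n+1] letters by the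
    choice of [alpha]. *)
Lemma rec_expansion (ka : int -> M) :
  (forall p, (-1 : int) <= p -> ka p = 0) ->
  (forall j, \sum_(i < 2 * n + 2) rec_coef (letter j) i *:
    ka (letter j - (2 * n + 1 - i)%N%:Z) = 0) ->
  forall p, ka p = \sum_(k <- nodes n) letter_at F k p *:
    \sum_(j < 2 * n + 1) alpha k j *: ka (letter j).
Proof.
move=> bad rec p; have [p_ge|[j0 ->]] := letter_split p.
  by rewrite bad // big1 // => k _; rewrite letter_at_ge // scale0r.
apply/eqP; rewrite -subr_eq0; apply/eqP.
pose G k := \sum_(j < 2 * n + 1) alpha k j *: ka (letter j).
pose ka' p := ka p - \sum_(k <- nodes n) letter_at F k p *: G k.
rewrite -[LHS]/(ka' (letter j0)); apply: rec_unique => [j|j jn].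
  under eq_bigr => i _ do rewrite scalerBr scaler_sumr.
  rewrite sumrB rec exchange_big big_seq big1 ?subrr // => k kn.
  under eq_bigr => i _ do rewrite scalerA.
  by rewrite -scaler_suml rec_letter_at // scale0r.
rewrite /ka'; under eq_bigr => k _ do rewrite scaler_sumr.
rewrite exchange_big (bigD1 (Ordinal jn)) //= [X in _ - (_ + X)]big1 => [|i ij].
  under eq_bigr => k _ do rewrite scalerA.
  by rewrite -scaler_suml alphaE // eqxx scale1r addr0 subrr.
under eq_bigr => k _ do rewrite scalerA.
rewrite -scaler_suml alphaE // (_ : (j == i :> nat) = false) ?scale0r //.
by apply: contraNF ij => /eqP E; apply/eqP/val_inj.
Qed.
End Recurrence.

(** [ev_fmode] concerns values at tuples; here [th] is arbitrary, because the expansion of [th] over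
    tuples is itself derived from this computation. *)
Lemma ev_fmode1 (M : lmodType F) (th : word -> M) (p q : int) (v : word) :
  (forall a : int, (-1 : int) <= a -> th (a :: v) = 0) ->
  ev th (fmode F [:: p] q v) =
  if q is Negz m then ((-1) ^+ m * gbinom F (p + 1) m) *: th ((p - m%:Z) :: v) else 0.
Proof.
move=> bad; rewrite fmode_cons ev_flatten.
have term i : ev th (fscale ((-1) ^+ i * gbinom F (p + 1) i)
    (fsub (Lact (p + 1 - i%:Z - 1) (fmode F [::] (q + i%:Z) v))
      (fscale ((-1) ^+ absn (p + 1))
        (fmode F [::] (p + 1 + q - i%:Z) (i%:Z - 1 :: v))))) =
  if q + i%:Z == -1 then ((-1) ^+ i * gbinom F (p + 1) i) *: th ((p - i%:Z) :: v) else 0.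
  rewrite ev_scale ev_sub ev_Lact ev_scale.
  have -> : ev th (fmode F [::] (p + 1 + q - i%:Z) (i%:Z - 1 :: v)) = 0.
    rewrite /=; case: eqP => _; rewrite ?ev_cons ev_nil ?addr0 //.
    by rewrite bad ?scaler0 //; lia.
  rewrite scaler0 subr0 (_ : p + 1 - i%:Z - 1 = p - i%:Z); last by lia.
  by rewrite /=; case: eqP => _; rewrite ?ev_cons ev_nil ?scaler0 // scale1r addr0.
under eq_bigr => i _ do rewrite term.
case: q term => [q|m] _.
  by rewrite big1 // => i _; rewrite (_ : (_ == -1) = false) //; lia.
rewrite (bigD1_seq m) ?iota_uniq ?mem_iota //=; last by rewrite /absn; lia.
rewrite (_ : (_ == -1) = true); last by lia.
by rewrite big1 ?addr0 // => i im; rewrite (_ : (_ == -1) = false) //; lia.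
Qed.

Lemma ev_fcirc1 (M : lmodType F) (th : word -> M) (p : int) (v : word) :
  (forall a : int, (-1 : int) <= a -> th (a :: v) = 0) ->
  ev th (fcirc F n [:: p] v) =
  \sum_(i < 2 * n + 2) rec_coef p i *: th ((p - (2 * n + 1 - i)%N%:Z) :: v).
Proof.
move=> bad; rewrite ev_flatten.
under eq_bigr => i _ do rewrite ev_scale ev_fmode1 //.
set K := (_ + 3)%N; have nK : (2 * n + 2 <= K)%N by rewrite /K; lia.
rewrite -[K]subn0 -/(index_iota 0 _) (big_cat_nat (leq0n _) nK) /=.
rewrite [X in _ + X]big_nat [X in _ + X]big1 ?addr0 => [|i /andP[ni _]]; last first.
  have -> : i%:Z - (2 * n)%:Z - 2 = Posz (i - (2 * n + 2)) by lia.
  by rewrite scaler0.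
rewrite big_mkord; apply: eq_bigr => i _.
have -> : i%:Z - (2 * n)%:Z - 2 = Negz (2 * n + 1 - i) by have := ltn_ord i; lia.
by rewrite scalerA wt_cons /wt big_nil oppr0 sub0r addrC.
Qed.
End Slots.

(** * Induction on the length *)

Section Generation.
Variable F : fieldType.
Hypothesis F0 : [pchar F] =i pred0.
Variables (n : nat) (c : F) (M : lmodType F) (th : word -> M).
Hypothesis thP : forall v, ev th v = 0 <-> InGenAlg n c v.

Lemma ev_single w : ev th [:: (1, w)] = th w.
Proof. by rewrite ev_cons ev_nil scale1r addr0. Qed.

Lemma th_gen w : GenWord n w -> th w = 0.
Proof. by move=> Hw; rewrite -ev_single; apply/thP/IG_gen. Qed.

Lemma th_rel x : NRel n c x -> ev th x = 0.
Proof.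
by move=> /AnEq0_NRel Hx; apply/thP; apply: IG_eq Hx; apply: InGenAlg_nil.
Qed.

Lemma th_comm w1 a b w2 : exists z : F,
  th (w1 ++ a :: b :: w2) = th (w1 ++ b :: a :: w2) +
    (a - b)%:~R *: th (w1 ++ (a + b) :: w2) + z *: th (w1 ++ w2).
Proof.
set z := if a + b == 0 then ((a ^+ 3 - a)%:~R / 12%:R) * c else 0.
exists z; have := th_rel (NR_comm n c w1 w2 a b).
rewrite !ev_cons ev_nil /= scale1r scaleN1r !scaleNr addr0 -/z => /eqP.
by rewrite -!opprD subr_eq0 addrA => /eqP.
Qed.

Lemma th_ann w m : (-1 : int) <= m -> th (rcons w m) = 0.
Proof. by move=> Hm; rewrite -ev_single; apply: th_rel; apply: NR_ann. Qed.

Lemma th_star u v : th u = 0 -> th v = 0 -> ev th (fstarW F n u v) = 0.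
Proof.
rewrite -(ev_single u) -(ev_single v) => /thP Hu /thP Hv.
have /thP := IG_mul Hu Hv.
by rewrite /fstar /= cats0 ev_scale mulr1 scale1r.
Qed.

(** Up to multiples of the vacuum, [(L(-1) + L(0)) L(-j-2) 1] is
    [(j+1) L(-j-3) 1 + (j+2) L(-j-2) 1], so every word of length one reduces to the generator
    [L(-2) 1]. *)
Lemma th_size1 w : size w = 1%N -> th w = 0.
Proof.
case: w => [|p []] //= _; have [p_ge|[j ->]] := letter_split p.
  by rewrite (@th_ann [::]).
elim: j => [|j IH]; first by apply: th_gen; right; exists 1%N.
have [z E1] := th_comm [::] (-1) (letter j) [::].
have [z' E2] := th_comm [::] 0 (letter j) [::].
have := th_rel (NR_L n c [:: letter j]).
rewrite !ev_cons ev_nil !scale1r addr0 /= E1 E2 /=.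
rewrite (@th_ann [:: _] (-1)) // (@th_ann [:: _] 0) // !add0r IH scaler0 add0r.
have -> : th [::] = 0 by apply: th_gen; apply: GenWord_nil.
rewrite !scaler0 !addr0 => /eqP; rewrite scaler_eq0 intz_eq0 //.
rewrite (_ : -1 + letter j = letter j.+1); last by rewrite /letter; lia.
by case/orP=> [|/eqP//]; rewrite /letter; lia.
Qed.

Section Step.
Variable s : nat.
Hypothesis s_gt1 : (1 < s)%N.
Hypothesis th_short : forall w, (size w < s)%N -> th w = 0.

Lemma th_perm w w' : size w = s -> perm_eq w w' -> th w = th w'.
Proof.
apply: perm_invariant => w1 a b w2 sz; have [z ->] := th_comm w1 a b w2.
rewrite (th_short (w := w1 ++ (a + b) :: w2)) ?(th_short (w := w1 ++ w2)).
- by rewrite !scaler0 !addr0.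
- by rewrite -sz !size_cat /=; lia.
- by rewrite -sz !size_cat /=; lia.
Qed.

Lemma th_bad w1 (p : int) w2 : size (w1 ++ p :: w2) = s -> (-1 : int) <= p ->
  th (w1 ++ p :: w2) = 0.
Proof.
move=> sz p_ge; rewrite (@th_perm _ (rcons (w1 ++ w2) p)) ?th_ann //.
by rewrite -cats1 -catA perm_cat2l -cat1s perm_catC.
Qed.

(** The relations [u o_n v] with [u] of length one give the recurrence in the first slot; as letters
    commute modulo shorter words, it holds in every slot. *)
Lemma th_expansion : exists ph : seq int -> M,
  (forall w, size w = s ->
     th w = \sum_(d <- points (nodes n) s) word_at F d w *: ph d) /\
  (forall d d', size d = s -> perm_eq d d' -> ph d = ph d').
Proof.
have [alpha [_ alphaE]] := dual_basis_exists F0 n.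
exists (phi (2 * n + 1) alpha th); split=> [|d d' sd dd']; last first.
  by apply: phi_perm => // w w' sw; apply: th_perm; rewrite sw.
apply: phi_expansion => w1 p w2 sz.
have front q : th (w1 ++ q :: w2) = th (q :: w1 ++ w2).
  by apply: th_perm; rewrite ?size_cat /= ?addnS // -cat1s perm_catCA.
rewrite front.
under [RHS]eq_bigr => k _ do under eq_bigr => j _ do rewrite front.
have szv (a : int) : size (a :: w1 ++ w2) = s by rewrite /= size_cat.
have bad (a : int) : (-1 : int) <= a -> th (a :: w1 ++ w2) = 0.
  exact: (@th_bad [::] a (w1 ++ w2) (szv a)).
apply: (rec_expansion F0 alphaE (ka := fun p => th (p :: w1 ++ w2))) => // j.
by rewrite -ev_fcirc1 //; apply: th_rel; apply: NR_circ.
Qed.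

(** * Relations on the coefficients at tuples of eigenvalues *)

Variable ph : seq int -> M.
Hypothesis phE : forall w, size w = s ->
  th w = \sum_(d <- points (nodes n) s) word_at F d w *: ph d.
Hypothesis ph_perm : forall d d', size d = s -> perm_eq d d' -> ph d = ph d'.

(** The words in the first [2n+1] letters separate all tuples of nodes, so vanishing vectors [X u v]
    that scale the coefficient at each tuple by [C] make every scaled coefficient vanish. *)
Lemma point_relation (C : int -> F) (X : word -> word -> fvec F) a :
  (forall u v, homog (size u + size v) (X u v)) ->
  (forall u v d1 d2, size d1 = size u -> size d2 = size v ->
    ev (fun w => word_at F (d1 ++ d2) w : F^o) (X u v) =
    C (\sum_(k <- d1) k) * word_at F (d1 ++ d2) (u ++ v)) ->
  (forall u v, size u = a -> (size u + size v)%N = s -> ev th (X u v) = 0) ->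
  forall d1 d2, size d1 = a -> d1 ++ d2 \in points (nodes n) s ->
    C (\sum_(k <- d1) k) *: ph (d1 ++ d2) = 0.
Proof.
move=> homX evX X0 d1 d2 sd1 dp.
have [alpha [alphaE _]] := dual_basis_exists F0 n.
pose psi d := C (\sum_(k <- take a d) k) *: ph d.
have -> : C (\sum_(k <- d1) k) *: ph (d1 ++ d2) = psi (d1 ++ d2).
  by rewrite /psi -sd1 take_size_cat.
have a_le : (a <= s)%N.
  by move: dp; rewrite mem_points size_cat sd1 => /andP[/eqP <- _]; rewrite leq_addr.
apply: (@points_extraction F M (nodes n) (iota 0 (2 * n + 1)) predT pred0
  (uniq_nodes n) _ s psi) => //; last exact: all_predT.
- move=> k0 k0n _; exists (alpha k0) => k kn _.
  by rewrite sum_iota0 alphaE.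
- by move=> d _; rewrite has_pred0.
- move=> js sjs _; pose w := map letter js.
  have sw : size w = s by rewrite size_map.
  have su : size (take a w) = a by rewrite size_takel ?sw.
  have suv : (size (take a w) + size (drop a w))%N = s by rewrite -size_cat cat_take_drop.
  rewrite -[RHS](X0 (take a w) (drop a w)) //.
  rewrite (ev_expansion phE) //; last by rewrite -{1}suv.
  apply: eq_big_seq => d; rewrite mem_points => /andP[/eqP sd _].
  have := evX (take a w) (drop a w) (take a d) (drop a d).
  rewrite !cat_take_drop => ->; first by rewrite /psi scalerA mulrC.
    by rewrite su size_takel ?sd.
  by rewrite !size_drop sd sw.
Qed.

Lemma ph_circ d1 d2 : d1 ++ d2 \in points (nodes n) s ->
  ~~ (0 <= \sum_(k <- d1) k + n%:Z <= (2 * n)%N%:Z) -> ph (d1 ++ d2) = 0.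
Proof.
move=> dp d1_out.
have /eqP := point_relation (C := fun x => gbinom F (x + n%:Z) (2 * n + 1))
  (homog_fcirc F n) (ev_fcirc F0 n)
  (fun u v _ _ => th_rel (NR_circ n c u v)) (erefl (size d1)) dp.
rewrite scaler_eq0 gbinom_eq0 // => /orP[|/eqP//] E; case/negP: d1_out.
by move: E; rewrite addn1; lia.
Qed.

(** Symmetry moves the entry 0 to the front. With [u] a single letter, [s > 1] makes both factors
    shorter than [s], so [u *_n v] vanishes, and it scales this coefficient by [star_coef n 0],
    which is 1. *)
Lemma ph_zero d : d \in points (nodes n) s -> 0 \in d -> ph d = 0.
Proof.
rewrite mem_points => /andP[/eqP sd dn] d0.
have dd' : perm_eq d ([:: 0] ++ rem 0 d) by rewrite perm_to_rem.
have dp : [:: 0] ++ rem 0 d \in points (nodes n) s.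
  by rewrite mem_points -(perm_size dd') sd eqxx -(perm_all _ dd').
rewrite (ph_perm sd dd').
have := point_relation (homog_fstarW F n) (ev_fstarW F0 n) _ (erefl (size [:: 0%R])) dp.
rewrite big_seq1 star_coef0 // scale1r; apply=> u v /= su suv.
by apply: th_star; apply: th_short; lia.
Qed.

Lemma perm_block (k : int) d :
  perm_eq d (nseq (count_mem k d) k ++ [seq x <- d | x != k]).
Proof.
rewrite -size_filter -(all_pred1P _ _ (filter_all (pred1 k) d)) perm_sym.
by have /permPl := perm_filterC (pred1 k) d.
Qed.

(** The entries [k], collected in front, form a block whose sum exceeds [n] in absolute value, which
    [ph_circ] excludes. *)
Lemma ph_block (k : int) d : d \in points (nodes n) s ->
  (n < `|k| * count_mem k d)%N -> ph d = 0.
Proof.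
rewrite mem_points => /andP[/eqP sd dn] k_big.
rewrite (ph_perm sd (perm_block k d)) ph_circ //.
  by rewrite mem_points -(perm_size (perm_block k d)) sd eqxx -(perm_all _ (perm_block k d)).
rewrite big_nseq iter_addr_0 -mulr_natr natz.
by move: (count_mem k d) k_big => a; nia.
Qed.

Lemma Lmono_perm (w : word) : (forall x, x \in w -> exists2 j, x = letter j & (j < 2 * n)%N) ->
  perm_eq (Lmono n (fun k => count_mem (letter k) w)) w.
Proof.
move=> wl; apply/allP => x _ /=; apply/eqP.
have letE k : - (k + 2)%N%:Z = letter k by rewrite /letter; lia.
rewrite /Lmono count_flatten -map_comp sumnE big_map (perm_big _ (permEl (perm_rev _))) /=.
under eq_bigr => k _ do rewrite count_nseq letE /=.
have [j_x|no_x] := boolP (has (fun k => letter k == x) (iota 0 (2 * n))).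
  have /hasP[j jn /eqP jx] := j_x.
  rewrite (bigD1_seq j) ?iota_uniq //= jx eqxx mul1n big1 ?addn0 // => k kj.
  by rewrite (_ : (letter k == x) = false) // -jx; move: kj; rewrite /letter; lia.
rewrite big_seq big1 => [|k kn]; last first.
  by rewrite (negPf (hasPn no_x k kn)).
apply/esym/count_memPn/negP => /wl[j xj jn]; case/negP: no_x.
by apply/hasP; exists j; rewrite ?mem_iota // xj.
Qed.

(** The letters from [js] run from [L(-3)] to [L(-2n-1)], so the word has exactly [a] letters
    [L(-2)] and rearranges to a generator with [i_2 = a]. *)
Lemma th_generator a js : (a + size js)%N = s -> (2 * a <= n)%N -> (0 < n)%N ->
  all (mem (iota 1 (2 * n - 1))) js -> th (nseq a (letter 0) ++ map letter js) = 0.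
Proof.
move=> sz an n_gt0 jsJ; set w := _ ++ _.
have sw : size w = s by rewrite size_cat size_nseq size_map.
rewrite (th_perm sw (w' := Lmono n (fun k => count_mem (letter k) w))).
  apply: th_gen; left; exists (fun k => count_mem (letter k) w); split=> //.
  rewrite count_cat count_nseq /= ?eqxx mul1n (_ : count_mem _ (map _ _) = 0%N) ?addn0 //.
  apply/count_memPn/mapP => -[j jjs].
  by have := allP jsJ j jjs; rewrite /= mem_iota /letter; lia.
rewrite perm_sym; apply: Lmono_perm => x; rewrite mem_cat mem_nseq.
case/orP=> [/andP[_ /eqP ->]|/mapP[j jjs ->]]; first by exists 0%N => //; lia.
by exists j => //; have := allP jsJ j jjs; rewrite /= mem_iota; lia.
Qed.

Lemma uniq_points N r : uniq N -> uniq (points N r).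
Proof.
move=> uN; elim: r => //= r IH; apply: allpairs_uniq => //.
by move=> [x y] [x' y'] _ _ /= [-> ->].
Qed.

Lemma word_at_nseq0 d a : size d = a -> word_at F d (nseq a (letter 0)) = 1.
Proof. by move=> <-; elim: d => //= k d ->; rewrite gbinom0 mulr1. Qed.

(* Among Newton's polynomials only the constant one is nonzero at 2. *)
Lemma dual_basis_away_2 k0 : (1 < n)%N -> k0 \in nodes n -> k0 != 0 -> k0 != 2 ->
  exists e : nat -> F, forall k, k \in nodes n -> k != 0 ->
    \sum_(j <- iota 1 (2 * n - 1)) e j * letter_at F k (letter j) = (k == k0)%:R.
Proof.
move=> n_gt1 k0n k00 k02; pose r := [seq k <- nodes n | k != 0].
have rE k : (k \in r) = (k != 0) && (k \in nodes n) by rewrite mem_filter.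
(* Without 0 only [2n] nodes are left, so the letters [L(-2)] to [L(-2n-1)] suffice for
   interpolation. *)
have szr : (size r <= 2 * n)%N.
  rewrite -ltnS -[X in (_ < X)%N]addn1 -size_nodes size_filter.
  rewrite -(count_predC (fun k : int => k != 0)) -addn1 leq_add2l -has_count.
  by apply/hasP; exists 0; rewrite ?mem_nodes.
have k0r : k0 \in r by rewrite rE k00.
have [e eE] := lagrange_newton F0 (filter_uniq _ (uniq_nodes n)) k0r szr.
have split_sum k : \sum_(j < 2 * n) e j * gbinom F (k - 2) j =
    e 0%N + \sum_(j <- iota 1 (2 * n - 1)) e j * letter_at F k (letter j).
  rewrite -(sum_iota0 (2 * n) (fun j => e j * gbinom F (k - 2) j)) -[X in iota 0 X](subnKC (_ : 1 <= 2 * n)%N); last by lia.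
  by rewrite big_cons gbinom0 mulr1.
(* As [n >= 2], the point 2 is a node, and the Lagrange polynomial of [k0] vanishes there; so its
   constant Newton coefficient is 0 and [L(-2)] drops out. *)
have e0 : e 0%N = 0.
  have := eE 2; rewrite split_sum rE mem_nodes (eq_sym 2 k0) (negPf k02) => /(_ n_gt1).
  rewrite big_seq big1 ?addr0 // => j; rewrite mem_iota => /andP[j_gt0 _] /=.
  by apply/eqP; rewrite mulf_eq0 gbinom_eq0 // ltz_nat j_gt0 orbT.
by exists e => k kn k_0; rewrite -eE ?rE ?k_0 // split_sum e0 add0r.
Qed.

Lemma ph_vanish_gt1 d : (1 < n)%N -> d \in points (nodes n) s -> ph d = 0.
Proof.
move=> n_gt1; have [a] := ubnP (count_mem (2 : int) d); elim: a d => // a IH d.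
rewrite ltnS => da dp; have [d0|d0] := boolP (0 \in d); first exact: ph_zero.
have [big|small] := ltnP n (2 * count_mem (2 : int) d); first exact: (ph_block (k := 2)).
have := dp; rewrite mem_points => /andP[/eqP sd dn].
set b := count_mem (2 : int) d in da small *.
pose d' := [seq x <- d | x != 2].
have dd' : perm_eq d (nseq b (2 : int) ++ d') := perm_block 2 d.
have szd' : (b + size d')%N = s by rewrite -sd (perm_size dd') size_cat size_nseq.
have d'n : d' \in points (nodes n) (size d').
  rewrite mem_points eqxx; apply/allP => x; rewrite mem_filter => /andP[_ xd].
  exact: (allP dn).
rewrite (ph_perm sd dd').
have cat_p d1 d2 : d1 \in points (nodes n) b -> d2 \in points (nodes n) (size d') ->
    d1 ++ d2 \in points (nodes n) s.
  by rewrite !mem_points size_cat all_cat => /andP[/eqP-> ->] /andP[/eqP-> ->];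
    rewrite szd' eqxx.
(* [L(-2)] has value 1 at every eigenvalue, so the generators with [b] letters [L(-2)] only see this
   sum over [d1]; their other letters isolate [d'], whose entries are neither 0 nor 2. *)
have : \sum_(d1 <- points (nodes n) b) ph (d1 ++ d') = 0.
  apply: (@points_extraction F M (nodes n) (iota 1 (2 * n - 1))
    (fun k => (k != 0) && (k != 2)) (fun k => k == 0) (uniq_nodes n) _ (size d')
    (fun d2 => \sum_(d1 <- points (nodes n) b) ph (d1 ++ d2))) => //.
  - by move=> k0 k0n /andP[k00 k02]; apply: dual_basis_away_2.
  - move=> d2 d2p /hasP[x xd2 /eqP x0]; rewrite big_seq big1 // => d1 d1p.
    by apply: ph_zero; rewrite ?cat_p // mem_cat -x0 xd2 orbT.
  - move=> js sjs jsJ; rewrite -[RHS](@th_generator b js) ?sjs //; last by lia.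
    rewrite phE ?size_cat ?size_nseq ?size_map ?sjs // -szd' sum_points_cat exchange_big.
    apply: eq_bigr => d2 _; rewrite scaler_sumr; apply: eq_big_seq => d1.
    rewrite mem_points => /andP[/eqP sd1 _].
    by rewrite word_at_cat ?size_nseq // word_at_nseq0 // mul1r.
  - apply/allP => x; rewrite mem_filter => /andP[x2 xd]; rewrite x2 andbT.
    by apply: contraNneq d0 => <-.
have b2p : nseq b (2 : int) \in points (nodes n) b.
  rewrite mem_points size_nseq eqxx; apply/allP => x.
  by rewrite mem_nseq => /andP[_ /eqP ->]; rewrite inE mem_nodes.
(* Every other [d1] has fewer than [b] entries 2, so its term vanishes by induction. *)
rewrite (bigD1_seq (nseq b (2 : int))) ?uniq_points ?uniq_nodes //=.
rewrite big_seq_cond big1 ?addr0 // => d1 /andP[d1p d1b]; apply: IH; last exact: cat_p.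
apply: leq_trans da; rewrite count_cat (_ : count_mem _ d' = 0%N) ?addn0; last first.
  by apply/count_memPn; rewrite mem_filter eqxx.
move: d1p; rewrite mem_points => /andP[/eqP sd1 _].
rewrite ltn_neqAle -{2}sd1 count_size andbT; apply: contraNneq d1b => cd1.
have /all_pred1P -> : all (pred1 (2 : int)) d1 by rewrite all_count cd1 sd1.
by rewrite sd1.
Qed.

Lemma ph_vanish_1 d : n = 1%N -> d \in points (nodes n) s -> ph d = 0.
Proof.
move=> n1 dp; have [d0|d0] := boolP (0 \in d); first exact: ph_zero.
have [c1|c1] := ltnP 1 (count_mem (1 : int) d).
  by apply: (ph_block (k := 1)); rewrite // n1 mul1n.
have [c2|c2] := ltnP 1 (count_mem (-1 : int) d).
  by apply: (ph_block (k := -1)); rewrite // n1 mul1n.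
have := dp; rewrite mem_points => /andP[/eqP sd dn].
(* All entries are 1 or -1, and each of these occurs at most once, which forces length two. *)
have szd : (size d <= count_mem (1%R : int) d + count_mem ((-1)%R : int) d)%N.
  elim: d d0 dn {dp c1 c2 sd} => //= x d IH; rewrite inE negb_or mem_nodes.
  move=> /andP[x0 d0] /andP[x1 dn]; have {IH} := IH d0 dn.
  have : (x == 1) || (x == -1) by lia.
  by case/orP=> /eqP -> /=; lia.
have s2 : s = 2%N by lia.
have dd' : perm_eq d [:: 1; -1].
  have := perm_block 1 d; have -> : count_mem (1%R : int) d = 1%N by lia.
  move=> dd'; apply: (perm_trans dd'); rewrite /= perm_cons.
  have : (size [seq x <- d | x != 1 :> int] = 1)%N.
    by have := perm_size dd'; rewrite sd s2 /= => -[].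
  case E : [seq x <- d | x != 1 :> int] => [|y []] //= _.
  have : y \in [seq x <- d | x != 1 :> int] by rewrite E mem_head.
  rewrite mem_filter => /andP[y1 yd].
  have := allP dn y yd; rewrite inE mem_nodes n1 => yn.
  have y0 : y != 0 by apply: contraNneq d0 => <-.
  by rewrite (_ : y = -1) //; lia.
rewrite (ph_perm sd dd').
have zero2 (x : int) : x \in nodes 1 -> ph [:: x; x] = 0.
  move=> xn; have xp : [:: x; x] \in points (nodes n) s.
    by rewrite mem_points s2 /= n1 xn.
  have [x0|x0] := eqVneq x 0; first by apply: ph_zero; rewrite // x0 mem_head.
  by apply: (ph_block (k := x)); rewrite //= !eqxx n1; lia.
have zero_ (x : int) : x \in nodes 1 -> ph [:: 0; x] = 0 /\ ph [:: x; 0] = 0.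
  move=> xn; split; apply: ph_zero; rewrite ?inE ?eqxx ?orbT //;
    by rewrite mem_points s2 /= n1 xn mem_nodes.
(* [L(-2)^2 1] has value 1 at all nine pairs. The surviving pairs [(1,-1)] and [(-1,1)] have equal
   coefficients, so twice this coefficient is 0. *)
have /= := phE (w := [:: letter 0; letter 0]); rewrite s2 => /(_ erefl).
rewrite th_gen; last by right; exists 2%N.
have -> : points (nodes n) 2 = points [:: -1; 0; 1] 2 by rewrite n1.
rewrite /points /= !big_cons big_nil /= !gbinom0 !mulr1 !scale1r.
rewrite !zero2 ?mem_nodes // !(zero_ _ _).1 ?mem_nodes // !(zero_ _ _).2 ?mem_nodes //.
rewrite (ph_perm (d := [:: -1; 1]) (d' := [:: 1; -1])) ?s2 //.
rewrite !add0r !addr0 -mulr2n -scaler_nat => /esym/eqP.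
by rewrite scaler_eq0 (natr_eq0 F0) => /eqP.
Qed.
End Step.

Lemma th_eq0 : (0 < n)%N -> forall w, th w = 0.
Proof.
move=> n_gt0 w; have [s] := ubnP (size w); elim: s w => // s IH w.
rewrite ltnS leq_eqVlt => /orP[/eqP sw|]; last exact: IH.
case: (ltnP 1 s) => [s_gt1|]; last first.
  case: s sw {IH} => [/size0nil-> _|[sw _|//]]; last exact: th_size1.
  by apply: th_gen; apply: GenWord_nil.
have [ph [phE ph_perm]] := th_expansion s_gt1 IH.
rewrite phE // big_seq big1 // => d dp.
rewrite (_ : ph d = 0) ?scaler0 //; have [n_gt1|n_le1] := ltnP 1 n.
  exact: (ph_vanish_gt1 s_gt1 IH phE ph_perm).
by apply: (ph_vanish_1 s_gt1 IH phE ph_perm) => //; lia.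
Qed.
End Generation.

Lemma pchar_Cplx : [pchar Cplx] =i pred0.
Proof. exact: (Num.Theory.pchar_num (complex Rdefinitions.R)). Qed.

(* A_n(V_Vir(c,0)) is generated (as an algebra under *_n) by the classes of
   L(-2n-1)^{i_{2n+1}}...L(-2)^{i_2} 1 (2 i_2 <= n) and L(-2)^j 1 (j >= 1):
   every element of V (= every word) lies in the generated subalgebra. *)
Theorem theorem6p11 (c : Cplx) (n : nat) (hn : (0 < n)%N) :
  forall w : word, InGenAlg n c [:: (1%R, w)].
Proof.
move=> w; have [M [th thP]] := InGenAlg_quotient n c.
by apply/thP; rewrite (ev_single th) (th_eq0 pchar_Cplx thP).
Qed.
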